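(* Let $d\in\mathbb{N}_+$, $T>0$, and let $f\colon\mathbb{R}^d\times[0,T]\to\mathbb{R}^d$ be continuous in $t$ and such that there exists $L>0$ with $\|f(x,t)-f(y,t)\|\le L\|x-y\|$ for all $x,y\in\mathbb{R}^d$ and all $t\in[0,T]$. For $z_0\in\mathbb{R}^d$ let $\mathbf{z}_{z_0}\colon[0,T]\to\mathbb{R}^d$ be the solution of $\dot{\mathbf{z}}=f(\mathbf{z},t)$, $\mathbf{z}(0)=z_0$. Then for any compact set $K\subseteq\mathbb{R}^d$ and any $\varepsilon>0$ there exists a constant $P_{\varepsilon,T,K,f}$ such that for every integer $P\ge P_{\varepsilon,T,K,f}$ there exist parameters $(W_i,A_i^1,A_i^2,B_i)\in\mathbb{R}^d\times\mathbb{R}^{d\times d}\times\mathbb{R}^d\times\mathbb{R}^d$, $i=1,\dots,P$, such that $$\|\mathbf{z}_{z_0}(\cdot)-\mathbf{x}_{z_0}(\cdot)\|_{L^\infty([0,T];\mathbb{R}^d)}\le\varepsilon\quad\text{for all } z_0\in K,$$ where $\mathbf{x}_{z_0}\colon[0,T]\to\mathbb{R}^d$ is the solution of the semi-autonomous neural ODE $$\dot{\mathbf{x}}=\sum_{i=1}^P W_i\circ\boldsymbol{\sigma}(A_i^1\mathbf{x}+A_i^2 t+B_i),\qquad \mathbf{x}(0)=z_0.$$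
   Context: $\|\cdot\|$ is the Euclidean norm. $\circ$ denotes the Hadamard (componentwise) product of vectors. $\sigma(s)=\max\{s,0\}$ is the ReLU function and $\boldsymbol{\sigma}\colon\mathbb{R}^d\to\mathbb{R}^d$ applies $\sigma$ componentwise. The right-hand side of the neural ODE is globally Lipschitz in $\mathbf{x}$, so its solution exists and is unique on $[0,T]$. *)

(* Defs.v *)
From HB Require Import structures.
From mathcomp Require Import all_boot all_order all_algebra.
From mathcomp Require Import all_classical all_reals all_analysis.
Set Implicit Arguments. Unset Strict Implicit. Unset Printing Implicit Defensive.
Import Order.TTheory GRing.Theory Num.Theory.
Import numFieldNormedType.Exports.
Local Open Scope classical_set_scope.
Local Open Scope ring_scope.

Definition enorm {R : realType} {d : nat} (v : 'cV[R]_d) : R :=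
  Num.sqrt (\sum_(i < d) (v i 0) ^+ 2).

Definition relu {R : realType} (s : R) : R := Num.max s 0.
Definition relu_vec {R : realType} {d : nat} (v : 'cV[R]_d) : 'cV[R]_d :=
  map_mx relu v.

Definition hadamard {R : realType} {d : nat} (u v : 'cV[R]_d) : 'cV[R]_d :=
  \col_(j < d) (u j 0 * v j 0).

Definition neural_field {R : realType} {d P : nat}
  (W : 'I_P -> 'cV[R]_d) (A1 : 'I_P -> 'M[R]_d) (A2 B : 'I_P -> 'cV[R]_d)
  (x : 'cV[R]_d) (t : R) : 'cV[R]_d :=
  \sum_(i < P) hadamard (W i) (relu_vec (A1 i *m x + t *: A2 i + B i)).

(* x is a (classical) solution on [0,T] of x' = F(x,t), x(0) = x0:
   continuous on [0,T], differentiable on ]0,T[ with the prescribed derivative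
   (together with continuity of t |-> F(x t, t) this is the C^1 solution). *)
Definition is_solution {R : realType} {d : nat} (T : R)
  (F : 'cV[R]_d -> R -> 'cV[R]_d) (x0 : 'cV[R]_d) (x : R -> 'cV[R]_d) : Prop :=
  x 0 = x0 /\
  {within `[0, T], continuous x} /\
  (forall t, 0 < t < T -> is_derive t (1 : R) x (F (x t) t)).

(* Main.v *)
(** Coordinate [j] of the neural field is a shallow ReLU network with [P] neurons
whose weights are independent of those of the other coordinates, so it suffices
to approximate each [f_j] uniformly on a box.  Exponentials of affine forms of
[(x, t)] span an algebra, which is dense in the required sense: its closure
contains the coordinates, and a Bernstein operator in one variable at a time,
with coefficients in the closure, unfreezes the arguments of [f_j] one by one.
Each exponential is a function of a single affine form, hence a limit of
piecewise linear interpolants, that is of sums of ReLU ridge functions.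
Finally, Gronwall's inequality applied to squared norms bounds the trajectories
starting in [K] and keeps the network's trajectories in the box. *)

Require Import Defs.
From HB Require Import structures.
From mathcomp Require Import all_boot all_order all_algebra.
From mathcomp Require Import all_classical all_reals all_analysis.
From mathcomp Require Import ring lra.
Import Order.TTheory GRing.Theory Num.Theory.
Import numFieldNormedType.Exports.
Local Open Scope classical_set_scope.
Local Open Scope ring_scope.
Set Implicit Arguments. Unset Strict Implicit. Unset Printing Implicit Defensive.

(** * Closed algebras of functions and Bernstein operators *)

(** Built one summand at a time, so that closure properties follow by induction with no index set to
    carry. *)
Inductive lin_span {R : realType} {X : Type} (S : (X -> R) -> Prop) :
    (X -> R) -> Prop :=
| lin_span0 : lin_span S (fun=> 0)
| lin_spanDZ c g h :
    S g -> lin_span S h -> lin_span S (fun p => c * g p + h p).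

Definition unif_closure {R : realType} {X : Type} (D : set X)
    (A : (X -> R) -> Prop) (h : X -> R) : Prop :=
  forall e : R, 0 < e -> exists g, A g /\ forall p, D p -> `|h p - g p| <= e.

Definition bounded_on {R : realType} {X : Type} (D : set X) (h : X -> R) :=
  exists B : R, forall p, D p -> `|h p| <= B.

Definition closed_subalgebra {R : realType} {X : Type} (D : set X)
    (A : (X -> R) -> Prop) : Prop :=
  [/\ forall c, A (fun=> c),
      forall g h, A g -> A h -> A (fun p => g p + h p),
      forall g h, A g -> A h -> A (fun p => g p * h p) &
      forall h, unif_closure D A h -> A h].

Lemma lin_spanD {R : realType} {X : Type} (S : (X -> R) -> Prop) g h :
  lin_span S g -> lin_span S h -> lin_span S (fun p => g p + h p).
Proof.
move=> Sg Sh; elim: Sg => [|c k {}g Sk _ IH].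
  by rewrite (_ : (fun p => _) = h)//; apply/funext => p; rewrite add0r.
rewrite (_ : (fun p => _) = (fun p => c * k p + (g p + h p))).
  exact: lin_spanDZ.
by apply/funext => p; rewrite addrA.
Qed.

Lemma lin_spanZ {R : realType} {X : Type} (S : (X -> R) -> Prop) a h :
  lin_span S h -> lin_span S (fun p => a * h p).
Proof.
elim=> [|c k {}h Sk _ IH].
  rewrite (_ : (fun p => _) = (fun=> 0)); first exact: lin_span0.
  by apply/funext => p; rewrite mulr0.
rewrite (_ : (fun p => _) = (fun p => (a * c) * k p + a * h p)).
  exact: lin_spanDZ.
by apply/funext => p; rewrite mulrDr mulrA.
Qed.

Lemma lin_span1 {R : realType} {X : Type} (S : (X -> R) -> Prop) h :
  S h -> lin_span S h.
Proof.
move=> Sh; rewrite (_ : h = (fun p => 1 * h p + (fun=> 0) p)).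
  by apply: lin_spanDZ => //; exact: lin_span0.
by apply/funext => p; rewrite mul1r addr0.
Qed.

Lemma lin_spanM {R : realType} {X : Type} (S : (X -> R) -> Prop) g h :
  (forall u v, S u -> S v -> S (fun p => u p * v p)) ->
  lin_span S g -> lin_span S h -> lin_span S (fun p => g p * h p).
Proof.
move=> SM Sg Sh; elim: Sg => [|c k {}g Sk _ IH].
  rewrite (_ : (fun p => _) = (fun=> 0)); first exact: lin_span0.
  by apply/funext => p; rewrite mul0r.
rewrite (_ : (fun p => _) = (fun p => c * (k p * h p) + g p * h p)); last first.
  by apply/funext => p; rewrite mulrDl mulrA.
apply: lin_spanD IH; apply: lin_spanZ.
elim: Sh => [|b l {}h Sl _ IH].
  rewrite (_ : (fun p => _) = (fun=> 0)); first exact: lin_span0.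
  by apply/funext => p; rewrite mulr0.
rewrite (_ : (fun p => _) = (fun p => b * (k p * l p) + k p * h p)).
  by apply: lin_spanDZ IH; exact: SM.
by apply/funext => p; ring.
Qed.

Lemma bounded_on_lin_span {R : realType} {X : Type} (D : set X)
    (S : (X -> R) -> Prop) h :
  (forall u, S u -> bounded_on D u) -> lin_span S h -> bounded_on D h.
Proof.
move=> Sb; elim=> [|c g {}h Sg _ [B hB]].
  by exists 0 => p _; rewrite normr0.
have [C gC] := Sb _ Sg.
exists (`|c| * C + B) => p Dp.
rewrite (le_trans (ler_normD _ _))// lerD ?hB// normrM ler_wpM2l//.
exact: gC.
Qed.

Lemma sub_unif_closure {R : realType} {X : Type} (D : set X)
    (A : (X -> R) -> Prop) h : A h -> unif_closure D A h.
Proof. by move=> Ah e e0; exists h; split=> // p _; rewrite subrr normr0 ltW. Qed.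

Lemma unif_closure_idem {R : realType} {X : Type} (D : set X)
    (A : (X -> R) -> Prop) h :
  unif_closure D (unif_closure D A) h -> unif_closure D A h.
Proof.
move=> Ah e e0; have e20 : 0 < e / 2 by rewrite divr_gt0.
have [g [Ag gh]] := Ah _ e20; have [k [Ak kg]] := Ag _ e20.
exists k; split=> // p Dp.
rewrite (le_trans (ler_distD (g p) _ _))// (splitr e) lerD ?gh ?kg//.
Qed.

Lemma unif_closure_spanDZ {R : realType} {X : Type} (D : set X)
    (S : (X -> R) -> Prop) c g h :
  unif_closure D (lin_span S) g -> unif_closure D (lin_span S) h ->
  unif_closure D (lin_span S) (fun p => c * g p + h p).
Proof.
move=> Ag Ah e e0; have e20 : 0 < e / 2 by rewrite divr_gt0.
have c0 : 0 < `|c| + 1 by rewrite ltr_wpDl.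
have [g' [Ag' gg']] := Ag (e / 2 / (`|c| + 1)) (divr_gt0 e20 c0).
have [h' [Ah' hh']] := Ah _ e20.
exists (fun p => c * g' p + h' p); split.
  by apply: lin_spanD Ah'; exact: lin_spanZ.
move=> p Dp.
rewrite (_ : _ - _ = c * (g p - g' p) + (h p - h' p)); last by ring.
rewrite (le_trans (ler_normD _ _))// [leRHS](splitr e) lerD ?hh'// normrM.
have := gg' p Dp; rewrite ler_pdivlMr// mulrC => H.
by apply: le_trans H; rewrite ler_wpM2r// lerDl.
Qed.

(** Generators can be exchanged inside a closure; this is how density passes from exponentials to
    ReLU ridge functions. *)
Lemma unif_closure_span_sub {R : realType} {X : Type} (D : set X)
    (S S' : (X -> R) -> Prop) h :
  (forall u, S u -> unif_closure D (lin_span S') u) ->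
  unif_closure D (lin_span S) h -> unif_closure D (lin_span S') h.
Proof.
move=> SS' Sh; apply: unif_closure_idem => e e0.
have [g [Sg gh]] := Sh _ e0; exists g; split => //; move: Sg {gh}.
elim=> [|c k {}g Sk _ IH]; first exact/sub_unif_closure/lin_span0.
by apply: unif_closure_spanDZ => //; exact: SS'.
Qed.

Lemma bounded_on_unif_closure {R : realType} {X : Type} (D : set X)
    (S : (X -> R) -> Prop) h :
  (forall u, S u -> bounded_on D u) -> unif_closure D (lin_span S) h ->
  bounded_on D h.
Proof.
move=> Sb Sh; have [g [Sg gh]] := Sh 1 ltr01.
have [B gB] := bounded_on_lin_span Sb Sg.
exists (1 + B) => p Dp; rewrite -(subrK (g p) (h p)).
by rewrite (le_trans (ler_normD _ _))// lerD ?gh ?gB.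
Qed.

(** Boundedness of the generators on [D] is what lets products pass to uniform limits. *)
Lemma closed_subalgebra_span {R : realType} {X : Type} (D : set X)
    (S : (X -> R) -> Prop) :
  S (fun=> 1) -> (forall u v, S u -> S v -> S (fun p => u p * v p)) ->
  (forall u, S u -> bounded_on D u) ->
  closed_subalgebra D (unif_closure D (lin_span S)).
Proof.
move=> S1 SM Sb; split=> [c|g h Sg Sh|g h Sg Sh|h].
- apply: sub_unif_closure; rewrite (_ : (fun=> c) = (fun p : X => c * 1)).
    by apply: lin_spanZ; exact: lin_span1.
  by apply/funext => p; rewrite mulr1.
- rewrite (_ : (fun p => _) = (fun p => 1 * g p + h p)).
    exact: unif_closure_spanDZ.
  by apply/funext => p; rewrite mul1r.
- move=> e e0; have e20 : 0 < e / 2 by rewrite divr_gt0.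
  have [B gB] := bounded_on_unif_closure Sb Sg.
  have B0 : 0 < `|B| + 1 by rewrite ltr_wpDl.
  (* [h'] is fixed before [g'], so that the tolerance for [g'] can use a bound on [h'], as the
     splitting [g h - g' h' = g (h - h') + h' (g - g')] requires. *)
  have [h' [Sh' hh']] := Sh (e / 2 / (`|B| + 1)) (divr_gt0 e20 B0).
  have [C h'C] := bounded_on_lin_span Sb Sh'.
  have C0 : 0 < `|C| + 1 by rewrite ltr_wpDl.
  have [g' [Sg' gg']] := Sg (e / 2 / (`|C| + 1)) (divr_gt0 e20 C0).
  exists (fun p => g' p * h' p); split; first exact: lin_spanM.
  move=> p Dp.
  rewrite (_ : _ - _ = g p * (h p - h' p) + h' p * (g p - g' p)); last by ring.
  rewrite (le_trans (ler_normD _ _))// [leRHS](splitr e) lerD// normrM.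
    have := hh' p Dp; rewrite ler_pdivlMr// mulrC; apply: le_trans.
    rewrite ler_wpM2r// (le_trans (gB p Dp))// (le_trans (ler_norm B))//.
    by rewrite lerDl.
  have := gg' p Dp; rewrite ler_pdivlMr// mulrC; apply: le_trans.
  rewrite ler_wpM2r// (le_trans (h'C p Dp))// (le_trans (ler_norm C))//.
  by rewrite lerDl.
- exact: unif_closure_idem.
Qed.

(* The Bernstein operator, [bern y n g = E (g K)] for [K] binomial of
   parameters [n] and [y]. *)
Fixpoint bern {R : realType} (y : R) (n : nat) (g : nat -> R) : R :=
  if n is m.+1 then y * bern y m (g \o S) + (1 - y) * bern y m g else g 0%N.

Lemma bern_le {R : realType} (y : R) n (g h : nat -> R) : 0 <= y <= 1 ->
  (forall k, (k <= n)%N -> g k <= h k) -> bern y n g <= bern y n h.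
Proof.
move=> /andP[y0 y1]; elim: n g h => [|n IH] g h gh /=; first exact: gh.
rewrite lerD// ler_wpM2l ?subr_ge0// IH// => k kn; apply: gh => //.
exact: leqW.
Qed.

(* The second moment of the binomial law about [b]. *)
Lemma bern_quad {R : realType} (y a c b : R) n :
  bern y n (fun k => a + c * (k%:R - b) ^+ 2) =
  a + c * (n%:R * y * (1 - y) + (n%:R * y - b) ^+ 2).
Proof.
elim: n b => [|n IH] b /=; first by ring.
rewrite (_ : _ \o _ = fun k => a + c * (k%:R - (b - 1)) ^+ 2); last first.
  by apply/funext => k /=; rewrite -natr1; ring.
by rewrite !IH -natr1; ring.
Qed.

(** The recursion uses only constants, sums and products, so the coefficients may be members of [A]
    rather than numbers. *)
Lemma closed_subalgebra_bern {R : realType} {X : Type} (D : set X)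
    (A : (X -> R) -> Prop) (y : X -> R) n (g : nat -> X -> R) :
  closed_subalgebra D A -> A y ->
  (forall k, (k <= n)%N -> A (g k)) -> A (fun p => bern (y p) n (g^~ p)).
Proof.
move=> [Ac AD AM _] Ay; elim: n g => [|n IH] g Ag /=; first exact: Ag.
apply: (AD (fun p => _) (fun p => _)); apply: (AM _ (fun p => _)).
- exact: Ay.
- by apply: (IH (g \o S)) => k kn; apply: Ag.
- apply: (AD (fun=> 1)) => //.
  rewrite (_ : (fun p => _) = (fun p => -1 * y p)); first exact: (AM (fun=> -1)).
  by apply/funext => p; rewrite mulN1r.
- by apply: IH => k kn; apply: Ag; exact: leqW.
Qed.

(** Bernstein's proof of Weierstrass' theorem with function coefficients: [h p] is approached by the
    mean of [G (K / n) p], for [K] binomial of parameters [n] and [y p]. A modulus of the form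
    [e + C (y - s)^2] is averaged exactly by the second moment. *)
Lemma closed_subalgebra_subst01 {R : realType} {X : Type} (D : set X)
    (A : (X -> R) -> Prop) (y h : X -> R) (G : R -> X -> R) :
  closed_subalgebra D A -> A y ->
  (forall p, D p -> 0 <= y p <= 1) ->
  (forall s : R, 0 <= s <= 1 -> A (G s)) ->
  (forall e : R, 0 < e -> exists C : R, 0 <= C /\ forall p (s : R), D p -> 0 <= s <= 1 ->
     `|h p - G s p| <= e + C * (y p - s) ^+ 2) ->
  A h.
Proof.
move=> AA Ay y01 AG hG; have [_ _ _ Al] := AA.
apply: Al => e e0; have e20 : 0 < e / 2 by rewrite divr_gt0.
have [C [C0 hC]] := hG _ e20.
pose n := (Num.truncn (C / (e / 2))).+1.
have n0 : 0 < n%:R :> R by rewrite ltr0n.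
have Cn : C / n%:R <= e / 2.
  rewrite ler_pdivrMr// mulrC -ler_pdivrMr// ltW//; exact: truncnS_gt.
have kn01 k : (k <= n)%N -> 0 <= (k%:R : R) / n%:R <= 1.
  by move=> kn; rewrite divr_ge0//= ler_pdivrMr// mul1r ler_nat.
exists (fun p => bern (y p) n (fun k => G (k%:R / n%:R) p)); split.
  apply: (closed_subalgebra_bern (g := fun k => G (k%:R / n%:R)) AA Ay) => k kn.
  by apply: AG; exact: kn01.
move=> p Dp; have /andP[y0 y1] := y01 p Dp.
have sqE k : C * (y p - k%:R / n%:R) ^+ 2 =
    C / n%:R ^+ 2 * (k%:R - n%:R * y p) ^+ 2 by field; rewrite gt_eqF.
(* The variance of [K / n] is [y (1 - y) / n], at most [1 / n]. It is all that remains below, since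
   the squares are centred at the mean [n y]. *)
have var : C / n%:R ^+ 2 * (n%:R * y p * (1 - y p)) <= e / 2.
  apply: le_trans Cn.
  rewrite (_ : _ * _ = C / n%:R * (y p * (1 - y p))); last by field; rewrite gt_eqF.
  by rewrite ler_piMr ?divr_ge0// ?ltW//; nra.
have up : bern (y p) n (fun k => G (k%:R / n%:R) p) <= h p + e.
  apply: (le_trans (bern_le (h := fun k => (h p + e / 2) +
      (C / n%:R ^+ 2) * (k%:R - n%:R * y p) ^+ 2) _ _)).
  - exact: y01.
  - move=> k kn; have := hC p (k%:R / n%:R) Dp (kn01 k kn).
    by rewrite sqE ler_distlC => /andP[_]; rewrite addrA.
  - rewrite bern_quad subrr expr0n/= addr0.
    by lra.
have lo : h p - e <= bern (y p) n (fun k => G (k%:R / n%:R) p).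
  apply: (le_trans _ (bern_le (g := fun k => (h p - e / 2) +
      - (C / n%:R ^+ 2) * (k%:R - n%:R * y p) ^+ 2) _ _)).
  - rewrite bern_quad subrr expr0n/= addr0.
    by lra.
  - exact: y01.
  - move=> k kn; have := hC p (k%:R / n%:R) Dp (kn01 k kn).
    by rewrite sqE ler_distlC opprD mulNr addrA => /andP[].
by rewrite ler_distlC lo up.
Qed.

Lemma closed_subalgebra_subst {R : realType} {X : Type} (D : set X)
    (A : (X -> R) -> Prop) (a b : R) (y h : X -> R) (G : R -> X -> R) :
  a < b -> closed_subalgebra D A -> A y ->
  (forall p, D p -> a <= y p <= b) ->
  (forall s : R, a <= s <= b -> A (G s)) ->
  (forall e : R, 0 < e -> exists C : R, 0 <= C /\ forall p (s : R), D p -> a <= s <= b ->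
     `|h p - G s p| <= e + C * (y p - s) ^+ 2) ->
  A h.
Proof.
move=> ab AA Ay yab AG hG; have [Ac AD AM _] := AA.
have ba : 0 < b - a by rewrite subr_gt0.
pose r s := a + (b - a) * s.
have rab s : 0 <= s <= 1 -> a <= r s <= b.
  by move=> /andP[s0 s1]; rewrite /r; apply/andP; split; nra.
apply: (@closed_subalgebra_subst01 _ _ D A (fun p => (y p + - a) * (b - a)^-1) h
  (fun s => G (r s))) => //.
- by apply: (AM _ (fun=> _)) => //; apply: (AD _ (fun=> _)).
- move=> p Dp; have /andP[ya yb] := yab p Dp.
  rewrite divr_ge0 ?subr_ge0 ?(ltW ab)//= ler_pdivrMr// mul1r.
  by rewrite lerD2r.
- by move=> s s01; apply: AG; exact: rab.
- move=> e e0; have [C [C0 hC]] := hG e e0.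
  exists (C * (b - a) ^+ 2); split; first by rewrite mulr_ge0// sqr_ge0.
  move=> p s Dp s01; apply: le_trans (hC p (r s) Dp (rab s s01)) _.
  rewrite (_ : C * _ ^+ 2 * _ = C * (y p - r s) ^+ 2)// /r.
  by field; rewrite gt_eqF.
Qed.

(** * ReLU ridge functions are dense *)

(** There is no constant term: under the exponential it would be a scalar factor, and ReLU ridges
    add their own [c]. *)
Definition linform {R : realType} {d : nat} (a : 'cV[R]_d) (b : R)
    (p : 'cV[R]_d * R) : R := \sum_(i < d) a i 0 * p.1 i 0 + b * p.2.

Definition box {R : realType} {d : nat} (M T : R) : set ('cV[R]_d * R) :=
  [set p : 'cV[R]_d * R | (forall i, `|p.1 i 0| <= M) /\ 0 <= p.2 <= T].

Definition exp_ridge {R : realType} {d : nat} (u : 'cV[R]_d * R -> R) : Prop :=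
  exists a b, u = fun p => expR (linform a b p).

Definition relu_ridge {R : realType} {d : nat} (u : 'cV[R]_d * R -> R) : Prop :=
  exists a b c, u = fun p => relu (linform a b p + c).

Lemma linformD {R : realType} {d : nat} (a a' : 'cV[R]_d) b b' p :
  linform (a + a') (b + b') p = linform a b p + linform a' b' p.
Proof.
rewrite /linform mulrDl addrACA; congr (_ + _).
by rewrite -big_split; apply: eq_bigr => i _; rewrite mxE mulrDl.
Qed.

Lemma linformZ {R : realType} {d : nat} s (a : 'cV[R]_d) b p :
  linform (s *: a) (s * b) p = s * linform a b p.
Proof.
rewrite /linform mulrDr mulrA; congr (_ + _).
by rewrite mulr_sumr; apply: eq_bigr => i _; rewrite mxE mulrA.
Qed.

Lemma linform0 {R : realType} {d : nat} (p : 'cV[R]_d * R) : linform 0 0 p = 0.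
Proof. by have := linformZ 0 0 0 p; rewrite scale0r !mul0r. Qed.

Lemma linform_coord {R : realType} {d : nat} (i : 'I_d) (p : 'cV[R]_d * R) :
  linform (\col_j (j == i)%:R) 0 p = p.1 i 0.
Proof.
rewrite /linform mul0r addr0 (bigD1 i)//= mxE eqxx mul1r big1 ?addr0// => j ji.
by rewrite mxE (negbTE ji) mul0r.
Qed.

Lemma linform_time {R : realType} {d : nat} (p : 'cV[R]_d * R) :
  linform 0 1 p = p.2.
Proof.
by rewrite /linform mul1r big1 ?add0r// => i _; rewrite mxE mul0r.
Qed.

Lemma linform_bounded {R : realType} {d : nat} (M T : R) (a : 'cV[R]_d) b :
  exists B, 0 < B /\ forall p, box M T p -> `|linform a b p| <= B.
Proof.
exists (1 + (\sum_(i < d) `|a i 0|) * `|M| + `|b| * `|T|); split.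
  by rewrite -addrA ltr_pwDl// addr_ge0// mulr_ge0// sumr_ge0.
move=> p [pM /andP[p0 pT]]; rewrite (le_trans (ler_normD _ _))// lerD//.
  rewrite (le_trans (ler_norm_sum _ _ _))//.
  apply: (@le_trans _ _ ((\sum_(i < d) `|a i 0|) * `|M|)); last by rewrite lerDr.
  rewrite mulr_suml ler_sum// => i _.
  by rewrite normrM ler_wpM2l// (le_trans (pM i))// ler_norm.
by rewrite normrM ler_wpM2l// ger0_norm// (le_trans pT)// ler_norm.
Qed.

(** A product of exponentials of linear forms is the exponential of the sum of the forms. ReLU
    ridges lack this stability, whence the detour through exponentials. *)
Lemma closed_subalgebra_exp {R : realType} {d : nat} (M T : R) :
  closed_subalgebra (@box R d M T)
    (unif_closure (box M T) (lin_span exp_ridge)).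
Proof.
apply: closed_subalgebra_span.
- by exists 0, 0; apply/funext => p; rewrite linform0 expR0.
- move=> _ _ [a [b ->]] [a' [b' ->]]; exists (a + a'), (b + b').
  by apply/funext => p; rewrite linformD expRD.
- move=> _ [a [b ->]]; have [B [_ aB]] := linform_bounded M T a b.
  exists (expR B) => p Dp; rewrite ger0_norm ?expR_ge0// ler_expR.
  by rewrite (le_trans _ (aB p Dp))// ler_norm.
Qed.

(** From [1 + s <= exp s] and [1 - s <= exp (- s)]: the remainder lies between [0] and
    [s^2 / (1 - s)]. *)
Lemma expR_taylor1 {R : realType} (s : R) : s <= 2^-1 ->
  `|expR s - 1 - s| <= 2 * s ^+ 2.
Proof.
move=> s2; have := expR_ge1Dx s; have := expR_ge1Dx (- s).
rewrite expRN => H1 H2; rewrite ger0_norm; last by lra.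
have e0 := expR_gt0 s.
have : (1 - s) * expR s <= 1 by rewrite -ler_pdivlMr// mul1r.
by nra.
Qed.

(* [l = lim (exp (s l) - 1) / s] as [s] tends to [0]. *)
Lemma exp_closure_linform {R : realType} {d : nat} (M T : R) (a : 'cV[R]_d) b :
  unif_closure (box M T) (lin_span exp_ridge) (linform a b).
Proof.
move=> e e0; have [B [B0 aB]] := linform_bounded M T a b.
(* The inverse of a sum of two positive terms secures both [s B <= 1/2], for the Taylor bound, and
   [2 s B^2 <= e], for the final error. *)
pose s := (2 * B + 2 * B ^+ 2 / e)^-1.
have D0 : 0 < 2 * B + 2 * B ^+ 2 / e.
  by rewrite addr_gt0 ?divr_gt0 ?mulr_gt0 ?exprn_gt0.
have s0 : 0 < s by rewrite invr_gt0.
have sD : s * (2 * B + 2 * B ^+ 2 / e) = 1 by rewrite mulVf// gt_eqF.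
have q0 : 0 < 2 * B ^+ 2 / e by rewrite divr_gt0 ?mulr_gt0 ?exprn_gt0.
have sB : s * B <= 2^-1 by nra.
have sB2 : s * (2 * B ^+ 2) <= e.
  rewrite -[leRHS]mul1r -ler_pdivrMr// -mulrA; nra.
exists (fun p => s^-1 * expR (linform (s *: a) (s * b) p) + (- s^-1) * 1).
split.
  apply: (lin_spanDZ _ _ (g := fun p => expR (linform _ _ p))).
    by exists (s *: a), (s * b).
  apply: lin_spanZ; apply: lin_span1; exists 0, 0.
  by apply/funext => p; rewrite linform0 expR0.
move=> p Dp; rewrite linformZ; have := aB p Dp; set l := linform a b p => lB.
have lB' := lB; move: lB'; rewrite ler_norml => /andP[l1 l2].
have sl : s * l <= 2^-1 by nra.
have := expR_taylor1 sl; set E := expR _ => HE.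
rewrite (_ : l - _ = - (s^-1 * (E - 1 - s * l))); last by field; rewrite gt_eqF.
rewrite normrN normrM gtr0_norm ?invr_gt0// mulrC ler_pdivrMr//.
apply: le_trans HE _; apply: (@le_trans _ _ (s * (s * (2 * B ^+ 2)))).
  have : l ^+ 2 <= B ^+ 2 by nra.
  by rewrite exprMn; have := sqr_ge0 s; nra.
by rewrite mulrC ler_wpM2r// ltW.
Qed.

(** * Unfreezing the arguments one at a time *)

(** Interpolates between the constant [c] at [m = 0] and the full argument [x] at [m = d]. *)
Definition freeze {R : realType} {d : nat} (m : nat) (c x : 'cV[R]_d) : 'cV[R]_d :=
  \col_i (if (i < m)%N then x i 0 else c i 0).

(** Puts a Lipschitz bound into the form [e + C (y - s)^2] asked for by the substitution lemmas. *)
Lemma le_addC_sqr {R : realType} (e b k : R) : 0 < e -> b ^+ 2 <= k ->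
  b <= e + e^-1 * k.
Proof.
move=> e0 bk; apply: (@le_trans _ _ (e + e^-1 * b ^+ 2)); last first.
  by rewrite lerD2l ler_wpM2l// invr_ge0 ltW.
rewrite -(ler_pM2l e0) mulrDr mulrA divff ?gt_eqF// mul1r.
by have := sqr_ge0 (b - e); have := sqr_ge0 b; have := sqr_ge0 e; nra.
Qed.

(** Induction on the number of live coordinates. With none, only the time varies and the Bernstein
    coefficients are constants; each further coordinate is released by a Bernstein operator in that
    coordinate, whose coefficients lie in the closure by induction. *)
Lemma exp_closure_lipschitz {R : realType} {d : nat} (M T L : R)
    (g : 'cV[R]_d -> R -> R) : 0 < M -> 0 < T ->
  (forall x y t, 0 <= t <= T ->
     (g x t - g y t) ^+ 2 <= L ^+ 2 * \sum_i ((x - y) i 0) ^+ 2) ->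
  (forall x (e : R), 0 < e -> exists C : R, 0 <= C /\
     forall t s, 0 <= t <= T -> 0 <= s <= T ->
     `|g x t - g x s| <= e + C * (t - s) ^+ 2) ->
  unif_closure (box M T) (lin_span exp_ridge) (fun p => g p.1 p.2).
Proof.
move=> M0 T0 gL gC; set A := unif_closure _ _.
have AA : closed_subalgebra (box M T) A := closed_subalgebra_exp M T.
suff H m : (m <= d)%N -> forall c, A (fun p => g (freeze m c p.1) p.2).
  have := H d (leqnn d) 0; congr (A _); apply/funext => p; congr (g _ _).
  by apply/colP => i; rewrite mxE ltn_ord.
elim: m => [_ c|m IH md c].
  apply: (@closed_subalgebra_subst _ _ (box M T) A 0 T (fun p => p.2) _
    (fun s _ => g c s)) => //.
  - have := exp_closure_linform M T (0 : 'cV[R]_d) 1; congr (A _).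
    by apply/funext => p; exact: linform_time.
  - by move=> p [].
  - by have [Ac _ _ _] := AA.
  - move=> e e0; have [C [C0 HC]] := gC c e e0; exists C; split => // p s [_ p2] sT.
    rewrite (_ : freeze 0 c p.1 = c); first exact: HC.
    by apply/colP => i; rewrite mxE.
pose i0 := Ordinal md.
(* Freezing coordinate [m] at [s] changes the argument by [x_m - s] in that coordinate only. *)
pose c' s := \col_i (if i == i0 then s else c i 0).
have MM : - M < M by lra.
apply: (@closed_subalgebra_subst _ _ (box M T) A (- M) M (fun p => p.1 i0 0) _
    (fun s p => g (freeze m (c' s) p.1) p.2)) => //.
- have := exp_closure_linform M T (\col_j (j == i0)%:R : 'cV[R]_d) 0; congr (A _).
  by apply/funext => p; exact: linform_coord.
- by move=> p [pM _]; rewrite -ler_norml.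
- by move=> s _; apply: IH; exact: ltnW.
- move=> e e0; exists (e^-1 * L ^+ 2).
  split; first by rewrite mulr_ge0 ?sqr_ge0// invr_ge0 ltW.
  move=> p s [_ pT] _; rewrite -mulrA; apply: le_addC_sqr => //.
  rewrite real_normK ?num_real//; apply: le_trans (gL _ _ _ pT) _.
  rewrite ler_wpM2l ?sqr_ge0// (bigD1 i0)//= big1 ?addr0.
    by rewrite !mxE /= ltnSn ltnn eqxx.
  move=> i ii0; rewrite !mxE (negbTE ii0) ltnS leq_eqVlt.
  have /negbTE -> : (i : nat) != m by [].
  by case: ifP => _; rewrite subrr expr0n.
Qed.

(** * Piecewise linear interpolation *)

Definition relu_affine {R : realType} (u : R -> R) : Prop :=
  exists a c, u = fun s => relu (a * s + c).

Lemma lin_span_comp {R : realType} {X Y : Type} (S : (Y -> R) -> Prop)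
    (S' : (X -> R) -> Prop) (l : X -> Y) h :
  (forall u, S u -> S' (u \o l)) -> lin_span S h -> lin_span S' (h \o l).
Proof.
move=> SS'; elim=> [|c u {}h Su _ IH]; first exact: lin_span0.
by apply: (lin_spanDZ c (SS' _ Su) IH).
Qed.

(** The continuous step rising from 0 at [a] to 1 at [a + h], spelled so as to match
    [relu_affine]. *)
Definition ramp {R : realType} (a h s : R) : R :=
  h^-1 * relu (1 * s + - a) + (- h^-1) * relu (1 * s + - (a + h)).

Lemma ramp_le {R : realType} (a h s : R) : 0 < h -> s <= a -> ramp a h s = 0.
Proof.
move=> h0 sa; rewrite /ramp /relu !mul1r !max_r ?mulr0 ?addr0//; lra.
Qed.

Lemma ramp_ge {R : realType} (a h s : R) : 0 < h -> a + h <= s -> ramp a h s = 1.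
Proof.
move=> h0 sa; rewrite /ramp /relu !mul1r !max_l; [|lra|lra].
by field; rewrite gt_eqF.
Qed.

Lemma ramp01 {R : realType} (a h s : R) : 0 < h -> a <= s <= a + h ->
  0 <= ramp a h s <= 1.
Proof.
move=> h0 /andP[sa sb]; rewrite /ramp /relu !mul1r max_l ?max_r; [|lra|lra].
rewrite mulr0 addr0 mulrC divr_ge0; [|lra|lra].
by rewrite ler_pdivrMr//; lra.
Qed.

(** The interpolant at the nodes [a + k h] is built from left to right. It stays constant after its
    last node, so one ramp reaches the next value without disturbing the earlier cells. *)
Lemma relu_span_grid {R : realType} (phi : R -> R) (a b h w : R) : 0 < h ->
  (forall u v, u <= b -> v <= b -> `|u - v| <= h -> `|phi u - phi v| <= w) ->
  forall n, a + n%:R * h <= b -> exists N, [/\ lin_span relu_affine N,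
    forall s, a <= s <= a + n%:R * h -> `|phi s - N s| <= w &
    forall s, a + n%:R * h <= s -> N s = phi (a + n%:R * h)].
Proof.
move=> h0 phiw; elim=> [|n IH] nb.
  rewrite mul0r addr0 in nb *.
  (* [relu (0 * s + 1)] is the constant 1. *)
  exists (fun s => phi a * relu (0 * s + 1) + 0); split.
  - by apply: lin_spanDZ (lin_span0 _); exists 0, 1.
  - move=> s /andP[sa as_]; rewrite /relu mul0r add0r max_l// mulr1 addr0.
    by apply: phiw; [lra|lra|rewrite (_ : s = a) ?subrr ?normr0; lra].
  - by move=> s _; rewrite /relu mul0r add0r max_l// mulr1 addr0.
rewrite -natr1 mulrDl mul1r addrA in nb *.
have [|N [SN Nphi Nr]] := IH; first by lra.
set an := a + n%:R * h in nb Nphi Nr *.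
pose N' s := (phi (an + h) - phi an) * ramp an h s + N s.
have NE s : an <= s <= an + h -> `|phi s - N' s| <= w.
  move=> /andP[s1 s2].
  have /andP[r0 r1] : 0 <= ramp an h s <= 1 by rewrite ramp01// s1 s2.
  (* On the new cell [N' s] is the convex combination, of weight [r], of two node values that are
     both within [w] of [phi s]. *)
  rewrite /N' Nr//; set r := ramp _ _ _ in r0 r1 *.
  have := phiw s (an + h) _ _ _; have := phiw s an _ _ _.
  move=> H1 H2.
  have /H1 {}H1 : s <= b by lra.
  have /H1 {}H1 : an <= b by lra.
  have /H1 {}H1 : `|s - an| <= h by rewrite ler_norml; lra.
  have /H2 {}H2 : s <= b by lra.
  have /H2 {}H2 : an + h <= b by lra.
  have /H2 {}H2 : `|s - (an + h)| <= h by rewrite ler_norml; lra.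
  move: H1 H2; rewrite !ler_norml => /andP[H1 H2] /andP[H3 H4].
  by apply/andP; split; nra.
exists N'; split.
- apply: lin_spanD SN; apply: lin_spanZ.
  apply: lin_spanD; apply: lin_spanZ; apply: lin_span1;
    by [exists 1, (- an)|exists 1, (- (an + h))].
- move=> s /andP[sa sh]; have [sn|sn] := leP s an.
    by rewrite /N' ramp_le// mulr0 add0r; apply: Nphi; rewrite sa.
  by apply: NE; rewrite ltW.
- by move=> s sh; rewrite /N' ramp_ge// Nr; lra.
Qed.

(** For [v <= u], [exp u - exp v = exp u (1 - exp (v - u)) <= exp u (u - v)]. *)
Lemma expR_lipschitz {R : realType} (b u v : R) : u <= b -> v <= b ->
  `|expR u - expR v| <= expR b * `|u - v|.
Proof.
wlog vu : u v / v <= u.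
  move=> H ub vb; have [vu|/ltW uv] := leP v u; first exact: H.
  by rewrite distrC [`|u - v|]distrC; exact: H.
move=> ub _; rewrite !ger0_norm ?subr_ge0 ?ler_expR//.
have -> : expR v = expR u * expR (v - u) by rewrite -expRD; congr expR; lra.
have H := expR_ge1Dx (v - u); have e0 := expR_gt0 u.
have eb : expR u <= expR b by rewrite ler_expR.
by nra.
Qed.

Lemma relu_closure_exp {R : realType} {d : nat} (M T : R)
    (u : 'cV[R]_d * R -> R) :
  exp_ridge u -> unif_closure (box M T) (lin_span relu_ridge) u.
Proof.
move=> [a [b ->]] e e0; have [B [B0 aB]] := linform_bounded M T a b.
have E0 := expR_gt0 B.
(* Enough cells on [[-B, B]] for the Lipschitz constant [exp B] times the mesh to be at most [e]. *)
pose n := (Num.truncn (expR B * (2 * B) / e)).+1.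
have n0 : 0 < n%:R :> R by rewrite ltr0n.
pose h := 2 * B / n%:R.
have h0 : 0 < h by rewrite divr_gt0// mulr_gt0.
have nh : n%:R * h = 2 * B by rewrite mulrC divfK// gt_eqF.
have hE : expR B * h <= e.
  rewrite mulrA ler_pdivrMr// [e * _]mulrC -ler_pdivrMr// ltW//; exact: truncnS_gt.
have [||N [SN Nphi _]] := @relu_span_grid _ expR (- B) B h e h0 _ n.
- move=> x y xB yB xyh; apply: le_trans (expR_lipschitz xB yB) _.
  by apply: le_trans hE; rewrite ler_pM2l.
- by rewrite nh; lra.
exists (N \o linform a b); split.
  apply: lin_span_comp SN => _ [s [c ->]]; exists (s *: a), (s * b), c.
  by apply/funext => p /=; rewrite linformZ.
move=> p Dp; apply: Nphi; rewrite nh; have := aB p Dp.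
by rewrite ler_norml => /andP[? ?]; lra.
Qed.

(** * From linear spans to neural fields *)

Lemma relu_span_seq {R : realType} {d : nat} (h : 'cV[R]_d * R -> R) :
  lin_span relu_ridge h -> exists s : seq (R * 'cV[R]_d * R * R),
    forall p, h p =
      \sum_(q <- s) q.1.1.1 * relu (linform q.1.1.2 q.1.2 p + q.2).
Proof.
elim=> [|c u {}h [a [b [e ->]]] _ [s hs]].
  by exists [::] => p; rewrite big_nil.
by exists ((c, a, b, e) :: s) => p; rewrite big_cons hs.
Qed.

Lemma relu_span_neurons {R : realType} {d : nat} (h : 'cV[R]_d * R -> R) :
  lin_span relu_ridge h -> exists P0 : nat, forall P, (P0 <= P)%N ->
    exists (w : 'I_P -> R) (a : 'I_P -> 'cV[R]_d) (b c : 'I_P -> R),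
      forall p, h p = \sum_i w i * relu (linform (a i) (b i) p + c i).
Proof.
move=> /relu_span_seq[s hs]; exists (size s) => P sP.
(* Beyond the length of [s] the default tuple 0 has outer weight 0, so the surplus neurons
   contribute nothing. *)
pose q (i : nat) := nth 0 s i.
exists (fun i => (q i).1.1.1), (fun i => (q i).1.1.2), (fun i => (q i).1.2),
  (fun i => (q i).2) => p; rewrite hs (big_nth 0).
rewrite -(big_mkord xpredT (fun i : nat => (q i).1.1.1 *
  relu (linform (q i).1.1.2 (q i).1.2 p + (q i).2))).
rewrite (@big_cat_nat _ _ _ (size s) 0 P)//=.
rewrite -[LHS]addr0; congr (_ + _); rewrite big_nat_cond big1//.
by move=> i /andP[/andP[si _] _]; rewrite /q nth_default//= mul0r.
Qed.

Lemma neural_field_coord {R : realType} {d P : nat} (w : 'I_d -> 'I_P -> R)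
    (a : 'I_d -> 'I_P -> 'cV[R]_d) (b c : 'I_d -> 'I_P -> R) x t j :
  neural_field (fun i => \col_j w j i) (fun i => \matrix_(j, k) a j i k 0)
    (fun i => \col_j b j i) (fun i => \col_j c j i) x t j 0 =
  \sum_i w j i * relu (linform (a j i) (b j i) (x, t) + c j i).
Proof.
rewrite /neural_field summxE; apply: eq_bigr => i _.
rewrite !mxE /linform /= [t * _]mulrC; congr (_ * relu (_ + _ + _)).
by apply: eq_bigr => k _; rewrite !mxE.
Qed.

Lemma neural_field_approx {R : realType} {d : nat} (M T : R)
    (F : 'cV[R]_d -> R -> 'cV[R]_d) (e : R) : 0 < e ->
  (forall j, unif_closure (box M T) (lin_span relu_ridge)
     (fun p => F p.1 p.2 j 0)) ->
  exists P0 : nat, forall P, (P0 <= P)%N ->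
    exists (W : 'I_P -> 'cV[R]_d) (A1 : 'I_P -> 'M[R]_d) (A2 B : 'I_P -> 'cV[R]_d),
      forall x t, box M T (x, t) -> forall j,
        `|(F x t - neural_field W A1 A2 B x t) j 0| <= e.
Proof.
move=> e0 FC.
have /choice[N hN] j : exists N : nat, forall P, (N <= P)%N ->
    exists wabc : ('I_P -> R) * ('I_P -> 'cV[R]_d) * ('I_P -> R) * ('I_P -> R),
    forall p, box M T p -> `|F p.1 p.2 j 0 - \sum_i wabc.1.1.1 i *
      relu (linform (wabc.1.1.2 i) (wabc.1.2 i) p + wabc.2 i)| <= e.
  have [h [/relu_span_neurons[N hN] Fh]] := FC j e e0.
  exists N => P /hN[w [a [b [c hE]]]]; exists (w, a, b, c) => p Dp.
  by rewrite /= -hE Fh.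
(* The sum dominates every [N j], so all coordinates can share the width [P]. *)
exists (\sum_j N j)%N => P NP.
have NjP j : (N j <= P)%N by apply: leq_trans NP; rewrite (bigD1 j)//= leq_addr.
have /choice[q hq] j := hN j P (NjP j).
pose w j i := (q j).1.1.1 i; pose a j i := (q j).1.1.2 i.
pose b j i := (q j).1.2 i; pose c j i := (q j).2 i.
exists (fun i => \col_j w j i), (fun i => \matrix_(j, k) a j i k 0),
  (fun i => \col_j b j i), (fun i => \col_j c j i) => x t Dxt j.
have := hq j _ Dxt; rewrite -[\sum_i _](neural_field_coord w a b c x t j).
by rewrite !mxE.
Qed.

(** * Comparison of trajectories *)

Lemma within_continuous_dist {R : realType} (f : R -> R) (A : set R) (x e : R) :
  {within A, continuous f} -> A x -> 0 < e ->
  exists2 r, 0 < r & forall t, A t -> `|x - t| < r -> `|f x - f t| < e.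
Proof.
move=> /subspace_continuousP fc Ax e0.
have /cvgrPdist_lt/(_ e e0) := fc x Ax.
by move=> /nbhs_ballP[r /= r0 H]; exists r => // t At xt; exact: H.
Qed.

(** Heine's theorem, through the near-covering form of compactness: the radius tends to 0 from the
    right, and near each [x] half of the local radius suffices. *)
Lemma segment_unif_continuous {R : realType} (f : R -> R) (a b e : R) :
  {within `[a, b], continuous f} -> 0 < e ->
  exists2 r, 0 < r & forall s t, a <= s <= b -> a <= t <= b ->
    `|s - t| < r -> `|f s - f t| < e.
Proof.
move=> fc e0.
have /compact_near_coveringP/near_covering_withinP cov := @segment_compact R a b.
pose P (r s : R) := forall t, a <= t <= b -> `|s - t| < r -> `|f s - f t| < e.
have Pr0 : \forall r \near (0 : R)^'+, `[a, b] `<=` P r.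
  apply: (cov R (0 : R)^'+ P _) => x xab.
  have [r r0 fr] := within_continuous_dist fc xab (divr_gt0 e0 (ltr0n _ 2)).
  exists ([set s | `|x - s| < r / 2], [set i | i < r / 2]) => /=.
    split; last by apply: nbhs_right_lt; rewrite divr_gt0.
    by apply/nbhs_ballP; exists (r / 2); rewrite //= divr_gt0.
  move=> [s i] /= [xs ir] sab t tab st.
  rewrite (le_lt_trans (ler_distD (f x) _ _))// (splitr e) ltrD//.
    by rewrite distrC fr// (lt_trans xs)// ltr_pdivrMr// ltr_pMr// ltr1n.
  rewrite fr//= ?in_itv//; rewrite (le_lt_trans (ler_distD s _ _))//.
  by rewrite (splitr r) ltrD// (lt_trans st).
near (0 : R)^'+ => r; exists r => // s t sab tab.
have Pr : `[a, b] `<=` P r by near: r.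
by apply: Pr => //=; rewrite in_itv.
Unshelve. all: by end_near. Qed.

(** Uniform continuity covers [|t - s| < r]; farther apart, [(t - s)^2 / r^2 >= 1] and the total
    oscillation serves as a bound. *)
Lemma segment_quadratic_modulus {R : realType} (f : R -> R) (T e : R) :
  0 < T -> {within `[0, T], continuous f} -> 0 < e ->
  exists C : R, 0 <= C /\ forall t s, 0 <= t <= T -> 0 <= s <= T ->
    `|f t - f s| <= e + C * (t - s) ^+ 2.
Proof.
move=> T0 fc e0; have [r r0 fr] := segment_unif_continuous fc e0.
have [c _ fmax] := EVT_max (ltW T0) fc; have [b bT fmin] := EVT_min (ltW T0) fc.
have cb0 : 0 <= f c - f b by rewrite subr_ge0 fmax.
exists ((f c - f b) / r ^+ 2); split.
  by rewrite divr_ge0// sqr_ge0.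
move=> t s tT sT; have [ts|rts] := ltP `|t - s| r.
  rewrite (le_trans (ltW (fr _ _ tT sT ts)))// lerDl mulr_ge0 ?sqr_ge0//.
  by rewrite divr_ge0// sqr_ge0.
apply: (@le_trans _ _ (f c - f b)).
  have := fmax t tT; have := fmax s sT; have := fmin t tT; have := fmin s sT.
  by rewrite ler_norml; lra.
rewrite ler_wpDl ?(ltW e0)// mulrAC ler_pdivlMr ?exprn_gt0//.
rewrite ler_wpM2l// -[leRHS]real_normK ?num_real//.
by rewrite ler_sqr ?nnegrE ?(ltW r0).
Qed.

Lemma first_hitting_time {R : realType} (u : R -> R) (T q t : R) :
  {within `[0, T], continuous u} -> u 0 < q -> 0 <= t <= T -> q <= u t ->
  exists2 s, 0 < s <= T & q <= u s /\ forall r, 0 <= r < s -> u r < q.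
Proof.
move=> uc u0 /andP[t0 tT] qt.
pose A := [set r | 0 <= r <= T /\ q <= u r].
have At : A t by split => //; rewrite t0.
have lA : lbound A 0 by move=> r [/andP[]].
have iA : has_inf A by split; [exists t|exists 0].
have s0 : 0 <= inf A by apply: lb_le_inf => //; exists t.
have st : inf A <= t by apply: ge_inf => //; exists 0.
have sT : inf A <= T by apply: le_trans tT.
(* Otherwise [u < q] just after the infimum, where points of the set must occur. *)
have qs : q <= u (inf A).
  rewrite leNgt; apply/negP => us.
  have [||r r0 ur] := @within_continuous_dist _ _ _ (inf A) (q - u (inf A)) uc.
  - by rewrite /= in_itv/= s0.
  - by rewrite subr_gt0.
  have [v [vT qv] vr] := inf_adherent r0 iA.
  have sv : inf A <= v by apply: ge_inf => //; exists 0.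
  have := ur v; rewrite /= in_itv/= => /(_ vT).
  rewrite ler0_norm ?subr_le0// opprB ltrBlDl => /(_ vr).
  by rewrite ltr_norml => /andP[+ _]; lra.
exists (inf A).
  by rewrite sT andbT lt_neqAle s0 andbT; apply/eqP => s00; rewrite -s00 in qs; lra.
split=> // r /andP[r0 rs]; rewrite ltNge; apply/negP => qr.
have : inf A <= r.
  by apply: ge_inf; [exists 0|split => //; rewrite r0 (le_trans (ltW rs))].
by rewrite leNgt rs.
Qed.

(** * Gronwall's inequality for squared norms *)

(** Unlike the norm, its square is differentiable at 0. *)
Definition sqnorm {R : realType} {d : nat} (v : 'cV[R]_d) : R :=
  \sum_(i < d) v i 0 ^+ 2.

Lemma sqnorm_ge0 {R : realType} {d : nat} (v : 'cV[R]_d) : 0 <= sqnorm v.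
Proof. by apply: sumr_ge0 => i _; exact: sqr_ge0. Qed.

Lemma sqr_enorm {R : realType} {d : nat} (v : 'cV[R]_d) : enorm v ^+ 2 = sqnorm v.
Proof. by rewrite sqr_sqrtr// sqnorm_ge0. Qed.

Lemma enorm_le {R : realType} {d : nat} (v : 'cV[R]_d) (e : R) : 0 <= e ->
  (enorm v <= e) = (sqnorm v <= e ^+ 2).
Proof. by move=> e0; rewrite -sqr_enorm ler_sqr ?nnegrE// sqrtr_ge0. Qed.

(** Stands in for the triangle inequality, and is the source of the factors 2 in [2 * l], [2 * F]
    and [2 * w]. *)
Lemma sqnormD {R : realType} {d : nat} (v w : 'cV[R]_d) :
  sqnorm (v + w) <= 2 * sqnorm v + 2 * sqnorm w.
Proof.
rewrite /sqnorm !mulr_sumr -big_split ler_sum// => i _; rewrite mxE /=.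
by have := sqr_ge0 (v i 0 - w i 0); lra.
Qed.

Lemma sqr_coord_le {R : realType} {d : nat} (v : 'cV[R]_d) i :
  v i 0 ^+ 2 <= sqnorm v.
Proof.
by rewrite /sqnorm (bigD1 i)//= lerDl sumr_ge0// => j _; exact: sqr_ge0.
Qed.

Lemma sqnorm_le {R : realType} {d : nat} (v : 'cV[R]_d) (e : R) :
  (forall i, `|v i 0| <= e) -> sqnorm v <= d%:R * e ^+ 2.
Proof.
move=> ve; apply: (@le_trans _ _ (\sum_(i < d) e ^+ 2)).
  apply: ler_sum => i _; rewrite -real_normK ?num_real//.
  by rewrite ler_sqr ?nnegrE ?(le_trans _ (ve i)).
by rewrite sumr_const card_ord mulr_natl.
Qed.

Lemma continuous_sqnorm {R : realType} {d : nat} : continuous (@sqnorm R d).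
Proof.
apply: continuous_big => [|i _ v]; first exact: add_continuous.
apply: (@continuous_comp _ _ _ (fun w : 'cV[R]_d => w i 0) (fun x : R => x ^+ 2)).
  exact: coord_continuous.
exact: exprn_continuous.
Qed.

Lemma is_derive_coord {R : realType} {d : nat} (e : R -> 'cV[R]_d) t de i :
  is_derive t (1 : R) e de -> is_derive t (1 : R) (fun s => e s i 0) (de i 0).
Proof.
move=> [de1 de2]; have /derivable_mxP ed := de1.
by split; [exact: ed|rewrite -de2 derive_mx// mxE].
Qed.

Lemma is_derive_sqnorm {R : realType} {d : nat} (e : R -> 'cV[R]_d) t de :
  is_derive t (1 : R) e de ->
  is_derive t (1 : R) (sqnorm \o e) (\sum_i 2 * e t i 0 * de i 0).
Proof.
move=> ed.
rewrite (_ : sqnorm \o e = \sum_i (fun s => e s i 0) ^+ 2); last first.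
  by apply/funext => s; rewrite fct_sumE.
apply: is_derive_sum => i.
by have := is_deriveX 2 (is_derive_coord i ed); rewrite expr1.
Qed.

(** [(|e|^2 + b) exp (- (1 + a) t)] is nonincreasing, because [2 <e, e'> <= |e|^2 + |e'|^2 <= (1 +
    a) (|e|^2 + b)]. *)
Lemma sqnorm_gronwall {R : realType} {d : nat} (e de : R -> 'cV[R]_d)
    (a b s : R) : 0 <= a -> 0 <= b -> 0 <= s ->
  {within `[0, s], continuous e} ->
  (forall t : R, 0 < t < s -> is_derive t (1 : R) e (de t)) ->
  (forall t : R, 0 < t < s -> sqnorm (de t) <= a * sqnorm (e t) + b) ->
  sqnorm (e s) + b <= (sqnorm (e 0) + b) * expR ((1 + a) * s).
Proof.
move=> a0 b0 s0 ec ed deb.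
pose v t := (sqnorm (e t) + b) * expR (- (1 + a) * t).
have vd t : 0 < t < s -> is_derive t (1 : R) v
    ((\sum_i 2 * e t i 0 * de t i 0 - (1 + a) * (sqnorm (e t) + b)) *
     expR (- (1 + a) * t)).
  move=> ts; have ud := is_derive_sqnorm (ed t ts).
  have xd : is_derive t (1 : R) (fun t => expR (- (1 + a) * t))
      (expR (- (1 + a) * t) * - (1 + a)).
    apply: (is_derive1_comp (f := expR) (g := fun t => - (1 + a) * t)).
    rewrite (_ : (fun t => _) = - (1 + a) \*: id)//.
    by apply: is_derive_eq; rewrite /GRing.scale/= mulr1.
  rewrite (_ : v = ((sqnorm \o e) + cst b) * (fun t => expR (- (1 + a) * t)))//.
  apply: is_derive_eq; rewrite /GRing.scale/= addr0.
  by rewrite -[((_ + _) t)]/(sqnorm (e t) + b); ring.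
have vle : v s <= v 0.
  apply: (@ler0_derive1_le_cc _ v 0 s) => //; rewrite ?in_itv/= ?lexx ?s0//.
  - by move=> t; rewrite in_itv/= => /vd[].
  - move=> t; rewrite in_itv/= => ts; rewrite derive1E.
    have [_ ->] := vd t ts; rewrite pmulr_lle0 ?expR_gt0//.
    have : \sum_i 2 * e t i 0 * de t i 0 <= sqnorm (e t) + sqnorm (de t).
      rewrite /sqnorm -big_split ler_sum// => i _ /=.
      by have := sqr_ge0 (e t i 0 - de t i 0); lra.
    by have := deb t ts; have := mulr_ge0 a0 b0; lra.
  - move=> t; apply: cvgM.
      apply: cvgD; last exact: cvg_cst.
      apply: (@continuous_comp (subspace `[0, s]) _ _ e sqnorm t); first exact: ec.
      exact: continuous_sqnorm.
    apply: continuous_subspaceT => {}t.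
    apply: (@continuous_comp _ _ _ (fun t => - (1 + a) * t) expR).
      exact: mulrl_continuous.
    exact: continuous_expR.
move: vle; rewrite /v mulr0 expR0 mulr1 mulNr expRN ler_pdivrMr ?expR_gt0//.
Qed.

(** Gronwall applies to [z] itself, since [|f (z, t)|^2 <= 2 l |z|^2 + 2 F] on comparing with
    [f (0, t)]. *)
Lemma solution_bounded {R : realType} {d : nat} (T l F : R)
    (f : 'cV[R]_d -> R -> 'cV[R]_d) z0 z t :
  0 <= l -> (forall x y t, 0 <= t <= T ->
     sqnorm (f x t - f y t) <= l * sqnorm (x - y)) ->
  (forall t, 0 <= t <= T -> sqnorm (f 0 t) <= F) ->
  is_solution T f z0 z -> 0 <= t <= T ->
  sqnorm (z t) <= (sqnorm z0 + 2 * F) * expR ((1 + 2 * l) * T).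
Proof.
move=> l0 fL fF [zz0 [zc zd]] /andP[t0 tT].
have F0 : 0 <= F.
  by apply: le_trans (fF 0 _); rewrite ?sqnorm_ge0// lexx (le_trans t0).
have zct : {within `[0, t], continuous z}.
  by apply: continuous_subspaceW zc => s /=; rewrite !in_itv/=; lra.
have := @sqnorm_gronwall _ _ z (fun s => f (z s) s) (2 * l) (2 * F) t.
rewrite !mulr_ge0// zz0 => /(_ isT isT t0 zct) H.
apply: (@le_trans _ _ (sqnorm (z t) + 2 * F)); first by rewrite lerDl mulr_ge0.
apply: le_trans (H _ _) _ => [s /andP[s0 st]|s /andP[s0 st]|].
- by apply: zd; rewrite s0 (lt_le_trans st).
- have sT : 0 <= s <= T by lra.
  rewrite -[f _ _](subrK (f 0 s)) (le_trans (sqnormD _ _))// -mulrA.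
  by rewrite lerD// ler_wpM2l// ?fF//; have := fL (z s) 0 s sT; rewrite subr0.
- rewrite ler_wpM2l ?addr_ge0 ?sqnorm_ge0 ?mulr_ge0// ler_expR ler_wpM2l//.
  by rewrite addr_ge0// mulr_ge0.
Qed.

(* The field [g] is only close to [f] near the trajectory [z]; before the first
   time at which [x] leaves the tube of radius [sqrt q] around [z], Gronwall's
   inequality keeps it in a smaller tube, so this time does not exist. *)
Lemma solution_stability {R : realType} {d : nat} (T l w q : R)
    (f g : 'cV[R]_d -> R -> 'cV[R]_d) z0 z x t :
  0 <= l -> 0 <= w -> (forall x y t, 0 <= t <= T ->
     sqnorm (f x t - f y t) <= l * sqnorm (x - y)) ->
  (forall y t, 0 <= t <= T -> sqnorm (z t - y) < q ->
     sqnorm (f y t - g y t) <= w) ->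
  2 * w * expR ((1 + 2 * l) * T) < q ->
  is_solution T f z0 z -> is_solution T g z0 x ->
  0 <= t <= T -> sqnorm (z t - x t) < q.
Proof.
move=> l0 w0 fL fg wq [zz0 [zc zd]] [xz0 [xc xd]] tT.
have q0 : 0 < q by apply: le_lt_trans wq; rewrite !mulr_ge0 ?expR_ge0.
have ec : {within `[0, T], continuous (z - x)}.
  by move=> s; apply: cvgB; [exact: zc|exact: xc].
have uc : {within `[0, T], continuous (sqnorm \o (z - x))}.
  move=> s; apply: (@continuous_comp (subspace `[0, T]) _ _ (z - x) sqnorm s).
    exact: ec.
  exact: continuous_sqnorm.
have e0 : sqnorm ((z - x) 0) = 0.
  rewrite (_ : (z - x) 0 = z 0 - x 0)// zz0 xz0 subrr /sqnorm big1// => i _.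
  by rewrite mxE expr0n.
rewrite ltNge; apply/negP => qt.
have [|s /andP[s0 sT] [qs us]] := first_hitting_time uc _ tT qt.
  by rewrite /= e0.
have ecs : {within `[0, s], continuous (z - x)}.
  by apply: continuous_subspaceW ec => r /=; rewrite !in_itv/=; lra.
have := @sqnorm_gronwall _ _ (z - x) (fun r => f (z r) r - g (x r) r)
  (2 * l) (2 * w) s.
rewrite !mulr_ge0// e0 add0r => /(_ isT isT (ltW s0) ecs) H.
have : sqnorm ((z - x) s) + 2 * w <= 2 * w * expR ((1 + 2 * l) * s).
  apply: H => r /andP[r0 rs].
    have rT : 0 < r < T by lra.
    by apply: is_deriveB; [exact: zd|exact: xd].
  have rT : 0 <= r <= T by lra.
  (* Splitting at [f (x r) r] leaves a Lipschitz term and an approximation error, the latter small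
     because [x r] is still in the tube. *)
  rewrite -(subrKA (f (x r) r)) (le_trans (sqnormD _ _))// -mulrA.
  rewrite lerD// ler_wpM2l//; first exact: fL.
  by apply: fg => //; apply: us; lra.
have : 2 * w * expR ((1 + 2 * l) * s) <= 2 * w * expR ((1 + 2 * l) * T).
  rewrite ler_wpM2l ?mulr_ge0// ler_expR ler_wpM2l//.
  by rewrite addr_ge0// mulr_ge0.
have qs' : q <= sqnorm ((z - x) s) := qs.
by have : 0 <= 2 * w by [rewrite mulr_ge0|]; lra.
Qed.

(** * Uniform approximation of the trajectories starting in a compact set *)

(** The ambient norm on column vectors is the largest absolute entry, whence the factor [d]. *)
Lemma compact_sqnorm_bounded {R : realType} {d : nat} (K : set 'cV[R]_d) :
  compact K -> exists B, 0 <= B /\ forall v, K v -> sqnorm v <= B.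
Proof.
move=> /compact_bounded[M [_ KM]].
exists (d%:R * (`|M| + 1) ^+ 2); split; first by rewrite mulr_ge0 ?sqr_ge0.
move=> v Kv; apply: sqnorm_le => i.
have Mlt : M < `|M| + 1 by rewrite (le_lt_trans (ler_norm M))// ltrDl.
apply: le_trans (KM _ Mlt v Kv).
by rewrite [leRHS]/Num.Def.normr/= mx_normrE; exact: (le_bigmax _ _ (i, 0)).
Qed.

Lemma neural_field_approx_lipschitz {R : realType} {d : nat} (M T L w : R)
    (f : 'cV[R]_d -> R -> 'cV[R]_d) : 0 < M -> 0 < T -> 0 < w ->
  (forall x, {within `[0, T], continuous (f x)}) ->
  (forall x y t, 0 <= t <= T ->
     sqnorm (f x t - f y t) <= L ^+ 2 * sqnorm (x - y)) ->
  exists P0 : nat, forall P, (P0 <= P)%N ->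
    exists (W : 'I_P -> 'cV[R]_d) (A1 : 'I_P -> 'M[R]_d) (A2 B : 'I_P -> 'cV[R]_d),
      forall x t, box M T (x, t) ->
        sqnorm (f x t - neural_field W A1 A2 B x t) <= w.
Proof.
move=> M0 T0 w0 fc fL.
have d0 : 0 < d%:R + 1 + w :> R by rewrite addr_gt0// ltr_wpDl.
(* This choice gives [e <= 1] and [d e <= w], hence [d e^2 <= w]. *)
pose e := w / (d%:R + 1 + w).
have e0 : 0 < e by rewrite divr_gt0.
have e1 : e <= 1 by rewrite ler_pdivrMr// mul1r lerDr addr_ge0.
have de : d%:R * e ^+ 2 <= w.
  have ed : e * (d%:R + 1 + w) = w by rewrite divfK// gt_eqF.
  have dn0 : 0 <= d%:R :> R by [].
  have : d%:R * e <= w by nra.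
  by apply: le_trans; rewrite ler_wpM2l// expr2 ler_piMr// ltW.
have [|P0 HP0] := @neural_field_approx _ d M T f e e0.
  move=> j; apply: unif_closure_span_sub (@relu_closure_exp R d M T) _.
  apply: (exp_closure_lipschitz (L := L) (g := fun x t => f x t j 0)) => //.
  - move=> x y t tT; apply: le_trans (fL x y t tT).
    by have := sqr_coord_le (f x t - f y t) j; rewrite !mxE.
  - move=> x r r0; apply: segment_quadratic_modulus => // t.
    apply: (@continuous_comp (subspace `[0, T]) _ _ (f x)
      (fun v : 'cV[R]_d => v j 0) t); first exact: fc.
    exact: coord_continuous.
exists P0 => P /HP0[W [A1 [A2 [B HB]]]].
exists W, A1, A2, B => x t xt; apply: le_trans de.
by apply: sqnorm_le => i; exact: HB.
Qed.

Unset Implicit Arguments.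

Theorem theorem2p1 (R : realType) (d : nat) (hd : (0 < d)%N) (T : R) (hT : 0 < T)
  (f : 'cV[R]_d -> R -> 'cV[R]_d)
  (hfcont : forall x : 'cV[R]_d, {within `[0, T], continuous (fun t => f x t)})
  (hfLip : exists L : R, 0 < L /\
     forall (x y : 'cV[R]_d) (t : R), t \in `[0, T] ->
       enorm (f x t - f y t) <= L * enorm (x - y))
  (K : set 'cV[R]_d) (hK : compact K) (eps : R) (heps : 0 < eps) :
  exists P0 : nat, forall P : nat, (P0 <= P)%N ->
    exists (W : 'I_P -> 'cV[R]_d) (A1 : 'I_P -> 'M[R]_d) (A2 B : 'I_P -> 'cV[R]_d),
      forall z0 : 'cV[R]_d, K z0 ->
      forall (z x : R -> 'cV[R]_d),
        is_solution T f z0 z ->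
        is_solution T (neural_field W A1 A2 B) z0 x ->
        forall t : R, t \in `[0, T] -> enorm (z t - x t) <= eps.
Proof.
have [L [L0 fL]] := hfLip.
have fL2 x y t : 0 <= t <= T -> sqnorm (f x t - f y t) <= L ^+ 2 * sqnorm (x - y).
  move=> tT; rewrite -!sqr_enorm -exprMn ler_sqr ?nnegrE ?mulr_ge0 ?sqrtr_ge0 ?(ltW L0)//.
  by apply: fL; rewrite in_itv.
have [B [B0 KB]] := compact_sqnorm_bounded hK.
have [F fF] : exists F, forall t, 0 <= t <= T -> sqnorm (f 0 t) <= F.
  have uc : {within `[0, T], continuous (sqnorm \o f 0)}.
    move=> t; apply: (@continuous_comp (subspace `[0, T]) _ _ (f 0) sqnorm t).
      exact: hfcont.
    exact: continuous_sqnorm.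
  have [c _ fc] := EVT_max (ltW hT) uc.
  by exists (sqnorm (f 0 c)) => t tT; apply: fc; rewrite in_itv.
have l0 : 0 <= L ^+ 2 by exact: sqr_ge0.
have F0 : 0 <= F by rewrite (le_trans (sqnorm_ge0 (f 0 0)))// fF// lexx ltW.
pose E := expR ((1 + 2 * L ^+ 2) * T); have E0 : 0 < E by exact: expR_gt0.
(* A bound for [|z|^2] along every trajectory of [f] starting in [K]. *)
pose Z := (B + 2 * F) * E.
have Z0 : 0 <= Z by rewrite mulr_ge0 ?(ltW E0)// addr_ge0// mulr_ge0.
(* The squared tube radius: at most 1, so that the tubes fit in one box fixed in advance, and at
   most [eps^2] for the conclusion. *)
pose q := Num.min 1 (eps ^+ 2).
have q0 : 0 < q by rewrite lt_min ltr01 exprn_gt0.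
have q1 : q <= 1 by rewrite ge_min lexx.
have qe : q <= eps ^+ 2 by rewrite ge_min lexx orbT.
(* Makes the Gronwall bound [2 w E] equal to [q / 2], strictly below [q]. *)
pose w := q / (4 * E).
have w0 : 0 < w by rewrite divr_gt0 ?mulr_gt0.
have wq : 2 * w * E < q.
  rewrite (_ : _ * E = q / 2); first by lra.
  by rewrite /w; field; rewrite gt_eqF.
(* The half-width [Z + 2] of the box: [|z_i| <= Z + 1] follows from [z_i^2 <= Z], and the tube adds
   at most 1. *)
have M0 : 0 < Z + 2 by rewrite ltr_wpDl.
have [P0 HP0] := neural_field_approx_lipschitz M0 hT w0 hfcont fL2.
exists P0 => P /HP0[W [A1 [A2 [b HN]]]].
exists W, A1, A2, b => z0 Kz0 z x zsol xsol t; rewrite in_itv/= => tT.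
rewrite enorm_le ?(ltW heps)//; apply: le_trans qe; apply: ltW.
apply: (solution_stability l0 (ltW w0) fL2 _ wq zsol xsol tT) => y s sT yq.
apply: HN; split => //= i; rewrite ler_norml.
have zZ : sqnorm (z s) <= Z.
  apply: le_trans (solution_bounded l0 fL2 fF zsol sT) _.
  by rewrite ler_wpM2r ?(ltW E0)// lerD2r KB.
have := sqr_coord_le (z s) i; have := sqr_coord_le (z s - y) i; rewrite !mxE.
set zi := z s i 0; set yi := y i 0 => H1 H2.
have {}H1 : (zi - yi) ^+ 2 <= 1 by lra.
have {}H2 : zi ^+ 2 <= Z by lra.
have /andP[d1 d2] : -1 <= zi - yi <= 1 by apply/andP; split; nra.
have /andP[z1 z2] : - (Z + 1) <= zi <= Z + 1.
  by have := sqr_ge0 (zi - 1); have := sqr_ge0 (zi + 1); lra.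
by lra.
Qed.
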